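(* Let $M\ge N\ge 1$ be integers and let $k\ge 2$ be an integer (the number of eggs). Consider the two-dimensional critical line problem $x+y=V$ on the rectangle from $(0,0)$ to $(M,N)$ with $k$ eggs, searched with Method Two as described in the context. Then, under Method Two, in the worst-case scenario, the minimum number of drops $L_2^{(2)}(k)$ satisfies $$L_2^{(2)}(k)\ \le\ \left\lceil (k-1)\cdot M^{1/(k-1)}\right\rceil + 1 .$$
   Context: Critical line problem $x+y=V$: consider the rectangle with coordinates from $(0,0)$ to $(M,N)$, with $M,N$ integers and, without loss of generality, $M\ge N$. There is a unique critical line $x+y=V$ passing through the rectangle, where $V$ is an unknown positive constant. An egg dropped at a point $(a,b)$ remains intact and undamaged (and can be reused) if $a+b<V$, and breaks (and must be discarded) if $a+b\ge V$. All eggs behave identically. The goal is to split the $(M+1)(N+1)$ lattice points within and on the boundary of the rectangle into safe points (where the egg remains intact) and breaking points (where the egg breaks). The worst-case number of drops of a procedure is the number of drops that suffices whatever the value of $V$. Eggs may be dropped at any real-valued position of the rectangle. Method Two. With two eggs: drop the first egg at the diagonal points $(i,\,iN/M)$, $i=1,2,3,\dots$, until it breaks, say at $(T,\,TN/M)$. Then all points on or to the left of the line $y=-x+(T-1)(1+N/M)$ are safe and all points on or to the right of the line $y=-x+T(1+N/M)$ are breaking; use the second egg to test one lattice point on each line of slope $-1$ that contains lattice points strictly between these two lines. With $k\ge 3$ eggs: set one egg aside and use the other $k-1$ eggs to search along the diagonal of the rectangle, treated as a one-dimensional line of the $M$ points $(i,\,iN/M)$, $i=1,\dots,M$, by the one-dimensional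 recursive jump search (with one egg, test the points in increasing order until the egg breaks; with $j\ge 2$ eggs, choose a step size $S$, drop an egg at positions $S,2S,3S,\dots$ until it breaks, and then search the last interval of length $S$ recursively with the remaining $j-1$ eggs). The reserved egg is then used to test the final uncertain point. $L_2^{(2)}(k)$ is the minimum, over the choice of step sizes, of the worst-case number of drops under Method Two. *)

(* Defs.v *)
From HB Require Import structures.
From mathcomp Require Import all_boot all_order all_algebra.
From mathcomp Require Import all_classical all_reals all_analysis.

Set Implicit Arguments.
Unset Strict Implicit.
Unset Printing Implicit Defensive.

Import Order.TTheory GRing.Theory Num.Theory.

(* The drops actually made when one egg is dropped at the successive positions
   of s until it breaks: everything up to and including the first break. *)
Definition drop_until (T : Type) (br : pred T) (s : seq T) : seq T :=
  take (find br s).+1 s.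

(* One-dimensional jump search of the n untested points lo + 1, ..., lo + n,
   where lo is safe (or is the start) and lo + n + 1 is breaking (or is past
   the end), using (size steps).+1 eggs; the head h of steps is the step
   size of the current level.  Returns the list of points at which an egg is
   dropped, and the least breaking point (lo + n + 1 if all n points are safe).
   - After a break at lo + (i + 1) h, the h - 1 points strictly inside the last
     interval of length h are searched with one egg less (its right end is
     known to break and is not tested again).
   - If none of the multiples of h up to n breaks, the last interval is the
     incomplete one, which has n %% h untested points; it is also searched
     with one egg less. *)
Fixpoint jump_search (br : pred nat) (steps : seq nat) (lo n : nat) :
    seq nat * nat :=
  if steps is h :: steps' then
    let pts := [seq lo + i * h | i <- iota 1 (n %/ h)] in
    let i := find br pts in
    let rest := jump_search br steps' (lo + i * h)
                  (if i < n %/ h then h.-1 else n %% h) in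
    (drop_until br pts ++ rest.1, rest.2)
  else
    let pts := iota lo.+1 n in
    (drop_until br pts, lo + (find br pts).+1).

Section MethodTwo.
Context {R : realType}.
Implicit Types (V : R) (M N T c d k : nat) (steps : seq nat).
Local Open Scope ring_scope.

Definition breaks V (p : R * R) : bool := V <= p.1 + p.2.

Definition diag M N (i : nat) : R * R := (i%:R, i%:R * N%:R / M%:R).

(* The c for which the line x + y = c contains lattice points of the rectangle
   and lies strictly between the lines of slope -1 through the diagonal points
   of index T - 1 and T, in increasing order. *)
Definition uncertain_lines M N T : seq nat :=
  [seq c <- iota 0 (M + N).+1 |
     T.-1%:R * (1 + N%:R / M%:R) < c%:R :> R & c%:R < T%:R * (1 + N%:R / M%:R) :> R].

(* A lattice point of the rectangle on x + y = c, for c <= M + N: (c, 0) if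
   c <= M, and (M, c - M) otherwise. *)
Definition line_point M c : R * R := ((minn c M)%:R, (c - M)%N%:R).

(* The positions at which eggs are dropped by Method Two with k eggs, where
   steps lists the k - 2 step sizes used by the k - 1 eggs of the diagonal
   search.  For k = 2, steps is empty and the diagonal is searched point by
   point. *)
Definition method_two_drops M N steps V : seq (R * R) :=
  let js := jump_search (fun i => breaks V (diag M N i)) steps 0 M in
  [seq diag M N i | i <- js.1] ++
  drop_until (breaks V) [seq line_point M c | c <- uncertain_lines M N js.2].

(* The critical line x + y = V passes through the rectangle, and V > 0. *)
Definition suffices_drops M N steps : pred nat :=
  fun d => `[< forall V, 0 < V <= M%:R + N%:R ->
                 (size (method_two_drops M N steps V) <= d)%N >].

End MethodTwo.

Lemma size_drop_until (T : Type) (br : pred T) (s : seq T) :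
  size (drop_until br s) = if has br s then (find br s).+1 else size s.
Proof.
rewrite /drop_until size_take_min has_find.
by case: ltnP => [/minn_idPl | /leqW /minn_idPr].
Qed.

Lemma size_jump_search (br : pred nat) (steps : seq nat) (lo n : nat) :
  size (jump_search br steps lo n).1 <= n + sumn steps.
Proof.
elim: steps lo n => [|h steps IH] lo n /=.
  rewrite /drop_until size_take size_iota addn0.
  by case: ifP => // /ltnW.
rewrite size_cat; set pts := map _ _; set i := find br pts.
apply: leq_trans (leq_add (leqnn _) (IH _ _)) _.
have szp : size pts = n %/ h by rewrite size_map size_iota.
rewrite size_drop_until has_find szp -/i; case: ifP => [iS | _].
  rewrite addnA -addnA; apply: leq_add.
    exact: leq_trans iS (leq_div _ _).
  by rewrite leq_add2r leq_pred.
rewrite addnA; apply: leq_add; last by rewrite leq_addl.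
rewrite [X in _ <= X](divn_eq n h) leq_add2r.
by case: h @pts @i szp => [|h] *; rewrite ?divn0 // leq_pmulr.
Qed.

Lemma suffices_drops_ex (R : realType) (M N : nat) (steps : seq nat) :
  exists d, suffices_drops (R := R) M N steps d.
Proof.
exists ((M + sumn steps) + (M + N).+1); apply/asboolP => V _.
rewrite size_cat size_map leq_add ?size_jump_search //.
rewrite size_drop_until; set s := map _ _.
have -> : (M + N).+1 = size (iota 0 (M + N).+1) by rewrite size_iota.
apply: (@leq_trans (size s)); first by rewrite has_find; case: ifP.
by rewrite size_map size_filter count_size.
Qed.

Definition worst_case (R : realType) (M N : nat) (steps : seq nat) : nat :=
  ex_minn (suffices_drops_ex R M N steps).

Definition worst_case_value (R : realType) (M N k : nat) : pred nat :=
  fun d => `[< exists steps : (k - 2).-tuple nat,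
                 all (leq 1) steps /\ worst_case R M N steps = d >].

Lemma worst_case_value_ex (R : realType) (M N k : nat) :
  exists d, worst_case_value R M N k d.
Proof.
exists (worst_case R M N (nseq (k - 2) 1%N)); apply/asboolP.
by exists (nseq_tuple (k - 2) 1%N); split=> //; rewrite all_nseq orbT.
Qed.

(* The minimum, over the step sizes, of the worst-case number of drops. *)
Definition L2 (R : realType) (M N k : nat) : nat :=
  ex_minn (worst_case_value_ex R M N k).

(* Main.v *)
(** Take as step sizes the powers c^(k-2), ..., c of the least c with
    M <= c^(k-1). Below the first level each diagonal search interval has fewer
    points than the previous step, hence costs at most c - 1 drops, and the
    first level costs at most c - 1 drops too unless M = c^(k-1), when it costs
    c. For k >= 3 this total is strictly less than (k-1) M^(1/(k-1)), which pays
    for the two drops needed because two uncertain lines may remain. For k = 2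
    there is no such slack, but the diagonal point M is the corner of the
    rectangle, and only one uncertain line lies just before it. *)
Require Import Defs.
From HB Require Import structures.
From mathcomp Require Import all_boot all_order all_algebra.
From mathcomp Require Import all_classical all_reals all_analysis.
From mathcomp Require Import lra zify.
Import Order.TTheory GRing.Theory Num.Theory.
Local Open Scope ring_scope.

Lemma size_drop_until_le (T : Type) (br : pred T) (s : seq T) :
  (size (drop_until br s) <= size s)%N.
Proof. by rewrite size_drop_until has_find; case: ifP. Qed.

Fixpoint geometric_steps (c m : nat) : seq nat :=
  if m is m'.+1 then (c ^ m)%N :: geometric_steps c m' else [::].

Lemma size_geometric_steps (c m : nat) : size (geometric_steps c m) = m.
Proof. by elim: m => //= m ->. Qed.

Lemma geometric_steps_gt0 (c m : nat) :
  (0 < c)%N -> all (leq 1) (geometric_steps c m).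
Proof. by move=> c0; elim: m => //= m ->; rewrite expn_gt0 c0. Qed.

Lemma size_jump_search_geometric (br : pred nat) (c m lo n : nat) :
  (0 < c)%N ->
  (size (jump_search br (geometric_steps c m) lo n).1
     <= n %/ c ^ m + m * c.-1)%N.
Proof.
move=> c0; elim: m lo n => [|m IH] lo n /=.
  by rewrite expn0 divn1 addn0 -[leqRHS](size_iota lo.+1) size_drop_until_le.
have h0 : (0 < c ^ m.+1)%N by rewrite expn_gt0 c0.
have rest_le r : (r < c ^ m.+1)%N -> (r %/ c ^ m <= c.-1)%N.
  move=> lt_r; rewrite -ltnS prednK // ltn_divLR ?expn_gt0 ?c0 //.
  by rewrite -expnS.
rewrite size_cat; set pts := map _ _.
have szp : size pts = (n %/ c ^ m.+1)%N by rewrite size_map size_iota.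
apply: leq_add; first by rewrite -szp size_drop_until_le.
apply: leq_trans (IH _ _) _; rewrite mulSn leq_add2r; apply: rest_le.
(* A break leaves [c ^ m.+1 - 1] untested points and no break leaves a remainder modulo
   [c ^ m.+1]. *)
by case: ifP => _; rewrite ?prednK // ltn_mod.
Qed.

Section MethodTwoBounds.
Context (R : realType).
Implicit Types (V : R) (M N k d : nat) (steps : seq nat).

Lemma L2_le M N k steps d :
  size steps = (k - 2)%N -> all (leq 1) steps ->
  suffices_drops (R := R) M N steps d -> (L2 R M N k <= d)%N.
Proof.
move=> szs pos suff; rewrite /L2; case: ex_minnP => w _ w_min.
apply: (@leq_trans (worst_case R M N steps)).
  apply: w_min; apply/asboolP.
  have szs' : size steps == (k - 2)%N by rewrite szs.
  by exists (Tuple szs').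
by rewrite /worst_case; case: ex_minnP => w' _; apply.
Qed.

(** The values of [c] lie in an open interval of length at most [1 + N/M <= 2]. *)
Lemma size_uncertain_lines M N T :
  (N <= M)%N -> (size (uncertain_lines (R := R) M N T) <= 2)%N.
Proof.
move=> NM; set w : R := 1 + N%:R / M%:R.
have w2 : w <= 2.
  rewrite /w (_ : 2 = 1 + 1) // lerD2l.
  case: (posnP M) => [->|M0]; first by rewrite invr0 mulr0.
  by rewrite ler_pdivrMr ?ltr0n // mul1r ler_nat.
have w0 : 0 <= w by rewrite addr_ge0 // divr_ge0.
pose a := Num.truncn (T.-1%:R * w).
have /truncn_itv/andP[a1 a2] : 0 <= T.-1%:R * w by rewrite mulr_ge0.
(* Since [a] is the floor of the lower end, only these two integers can lie inside. *)
rewrite -[2%N]/(size [:: a.+1; a.+2]); apply: uniq_leq_size.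
  by rewrite filter_uniq ?iota_uniq.
move=> c; rewrite mem_filter => /andP[/andP[lo hi] _].
have T1 : T%:R * w <= T.-1%:R * w + 2.
  case: T {a a1 a2 lo hi} => [|T] /=; first by rewrite mul0r add0r.
  by rewrite mulrSr mulrDl mul1r lerD2l.
have /[!ltr_nat] ac : a%:R < c%:R :> R by exact: le_lt_trans a1 lo.
have /[!ltr_nat] ca : c%:R < (a.+1 + 2)%:R :> R.
  rewrite natrD; apply: lt_trans hi _; apply: le_lt_trans T1 _.
  by rewrite ltrD2r.
by rewrite !inE; lia.
Qed.

(** The upper end is now the integer [M + N], which is excluded; below it, within distance less than
    2, only [M + N - 1] remains. *)
Lemma size_uncertain_lines_last M N :
  (0 < M)%N -> (N <= M)%N -> (size (uncertain_lines (R := R) M N M) <= 1)%N.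
Proof.
move=> M0 NM; have M0' : 0 < M%:R :> R by rewrite ltr0n.
rewrite -[1%N]/(size [:: (M + N).-1]); apply: uniq_leq_size.
  by rewrite filter_uniq ?iota_uniq.
move=> c; rewrite mem_filter => /andP[/andP[lo hi] _]; rewrite inE.
have cornerE : M%:R * (1 + N%:R / M%:R) = (M + N)%:R :> R.
  by rewrite mulrDr mulr1 mulrC divfK ?gt_eqF // natrD.
move: hi; rewrite cornerE ltr_nat => hi.
have w2 : N%:R / M%:R <= 1 :> R by rewrite ler_pdivrMr // mul1r ler_nat.
have : (M + N)%:R < c%:R + 2 :> R.
  rewrite -cornerE -{1}(prednK M0) mulrSr mulrDl mul1r; lra.
by rewrite -natrD ltr_nat => lo'; lia.
Qed.

Lemma suffices_drops_geometric M N c m :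
  (0 < c)%N -> (N <= M)%N ->
  suffices_drops (R := R) M N (geometric_steps c m)
    (M %/ c ^ m + m * c.-1 + 2)%N.
Proof.
move=> c0 NM; apply/asboolP => V _; rewrite size_cat size_map.
apply: leq_add; first exact: size_jump_search_geometric.
apply: leq_trans (size_drop_until_le _ _ _) _.
by rewrite size_map size_uncertain_lines.
Qed.

(** A first break at [T < M] costs at most [T + 2 <= M + 1] drops; at [T = M] a single uncertain
    line gives [M + 1] again. *)
Lemma suffices_drops_sequential M N :
  (0 < M)%N -> (N <= M)%N -> suffices_drops (R := R) M N [::] M.+1.
Proof.
move=> M0 NM; apply/asboolP => V /andP[_ VMN].
rewrite size_cat size_map /= add0n; set br := (fun i => _).
have M0' : M%:R != 0 :> R by rewrite pnatr_eq0 -lt0n.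
(* As [V <= M + N], the corner breaks, so the diagonal search always ends with a break. *)
have br_last : has br (iota 1 M).
  apply/hasP; exists M; first by rewrite mem_iota; lia.
  by rewrite /br /breaks /= mulrC mulrA mulVf // mul1r.
rewrite size_drop_until br_last.
move: (br_last); rewrite has_find size_iota leq_eqVlt => lt_T.
set T := (find br _).+1 in lt_T *.
apply: (@leq_trans (T + size (uncertain_lines (R := R) M N T))).
  by rewrite leq_add2l (leq_trans (size_drop_until_le _ _ _)) ?size_map.
case/orP: lt_T => [/eqP ->|lt_T].
  by rewrite -addn1 leq_add2l size_uncertain_lines_last.
by have := size_uncertain_lines M N T NM; lia.
Qed.

Lemma natr_lt_root (x : R) (a j : nat) :
  (0 < j)%N -> a%:R ^+ j < x -> a%:R < x `^ (1 / j%:R).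
Proof.
move=> j0 ax; have j0' : j%:R != 0 :> R by rewrite pnatr_eq0 -lt0n.
have -> : a%:R = (a%:R ^+ j) `^ (1 / j%:R) :> R.
  by rewrite -powR_mulrn // -powRrM mulrC divfK // powRr1.
apply: gt0_ltr_powR; rewrite ?nnegrE ?exprn_ge0 //.
  by rewrite divr_gt0 // ltr0n.
by apply: ltW; apply: le_lt_trans ax; rewrite exprn_ge0.
Qed.

Lemma geometric_drops_lt M m : (0 < M)%N -> (0 < m)%N ->
  exists2 c : nat, (0 < c)%N &
    (M %/ c ^ m + m * c.-1)%N%:R < m.+1%:R * M%:R `^ (1 / m.+1%:R) :> R.
Proof.
move=> M0 m0; have exc : exists c, (M <= c ^ m.+1)%N.
  by exists M; rewrite expnS leq_pmulr // expn_gt0 M0.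
case: (ex_minnP exc) => c Mc c_min.
have c0 : (0 < c)%N by case: (c) Mc => //; rewrite exp0n //; lia.
have cm0 : (0 < c ^ m)%N by rewrite expn_gt0 c0.
exists c => //; move: Mc; rewrite leq_eqVlt => /orP[/eqP Mc | Mc].
  (* Here the root is exactly [c], and [c + m * (c - 1) < m.+1 * c] because [m > 0]. *)
  rewrite {1}Mc expnS mulnK // Mc natrX -powR_mulrn // -powRrM.
  rewrite mul1r mulfV ?pnatr_eq0 // powRr1 // -natrM ltr_nat; nia.
have dle : (M %/ c ^ m + m * c.-1 <= m.+1 * c.-1)%N.
  by rewrite mulSn leq_add2r -ltnS prednK // ltn_divLR // -expnS.
apply: (@le_lt_trans _ _ (m.+1 * c.-1)%N%:R); first by rewrite ler_nat.
rewrite natrM ltr_pM2l ?ltr0n //; apply: natr_lt_root => //.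
(* Minimality of [c] gives [c.-1 ^ m.+1 < M]. *)
rewrite -natrX ltr_nat ltnNge; apply/negP => /c_min; lia.
Qed.

End MethodTwoBounds.

Theorem theorem6p3 (R : realType) (M N k : nat)
    (hN : (1 <= N)%N) (hNM : (N <= M)%N) (hk : (2 <= k)%N) :
  (L2 R M N k)%:Z <=
    Num.ceil ((k - 1)%N%:R * M%:R `^ (1 / (k - 1)%N%:R) : R) + 1.
Proof.
have M0 : (0 < M)%N := leq_trans hN hNM.
case: k hk => [|[|[|m]]] // _.
  rewrite divr1 mul1r powRr1 // -[M%:R]/(M%:Z%:~R) intrKceil.
  have := L2_le R M N 2 [::] _ erefl isT (suffices_drops_sequential R M N M0 hNM).
  lia.
have [c c0 lt_c] := geometric_drops_lt R M m.+1 M0 isT.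
have := L2_le R M N m.+3 _ _ (size_geometric_steps c m.+1)
  (geometric_steps_gt0 c m.+1 c0) (suffices_drops_geometric R M N c m.+1 c0 hNM).
(* Between integers the strict inequality gains one drop; with the [+ 1] of the bound this covers
   the two uncertain lines. *)
have : ((M %/ c ^ m.+1 + m.+1 * c.-1)%N)%:Z <
    Num.ceil (m.+2%:R * M%:R `^ (1 / m.+2%:R) : R).
  by rewrite ceil_gt_int.
rewrite subn1 /=; set x := Num.ceil _; set d := (_ + _)%N; lia.
Qed.
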